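(* The ABLE neural operator can be nonlinear without any activation function: let $d\ge1$; there exist $M\ge1$, a measurable function $p:\mathbb{T}^d\times\mathbb{C}\times[M]\to\mathbb{R}_{\ge0}$ with $\sum_{m=1}^{M}p(\mathbf{x},v,m)=1$ for all $(\mathbf{x},v)\in\mathbb{T}^d\times\mathbb{C}$, and a bounded $R:\mathbb{Z}^d\times[M]\to\mathbb{C}$, such that the input-dependent ABLE operator $\mathcal{G}_{ABLE}:L^2(\mathbb{T}^d,\mathbb{C})\to L^2(\mathbb{T}^d,\mathbb{C})$, $$\mathcal{G}_{ABLE}(f)(\mathbf{x})=\sum_{m=1}^{M}\sqrt{p(\mathbf{x},f(\mathbf{x}),m)}\;\mathcal{F}^{-1}\Big[R(\cdot,m)\,\mathcal{F}\big(\sqrt{p(\cdot,f(\cdot),m)}\,f(\cdot)\big)\Big](\mathbf{x}),$$ is not a linear operator.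
   Context: $\mathbb{T}^d=\mathbb{R}^d/(2\pi\mathbb{Z})^d$, $[M]=\{1,\dots,M\}$. $\mathcal{F}(g)_{\mathbf{k}}=\frac{1}{(2\pi)^d}\int_{\mathbb{T}^d}g(\mathbf{x})e^{-i\mathbf{k}\cdot\mathbf{x}}d\mathbf{x}$ for $\mathbf{k}\in\mathbb{Z}^d$, and $\mathcal{F}^{-1}(c)(\mathbf{x})=\sum_{\mathbf{k}\in\mathbb{Z}^d}c_{\mathbf{k}}e^{i\mathbf{k}\cdot\mathbf{x}}$ (convergence in $L^2(\mathbb{T}^d)$). *)

(* Defs.v *)
From HB Require Import structures.
From mathcomp Require Import all_boot all_order all_algebra finmap.
From mathcomp Require Import ring_quotient complex.
From mathcomp Require Import all_classical all_reals all_analysis.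
From mathcomp Require Import measurable_realfun summability.
Import Order.TTheory GRing.Theory Num.Theory.
Import numFieldNormedType.Exports.
Import ComplexField.

Set Implicit Arguments.
Unset Strict Implicit.
Unset Printing Implicit Defensive.

Local Open Scope classical_set_scope.
Local Open Scope ring_scope.
Local Open Scope complex_scope.
Local Open Scope quotient_scope.

#[global] Existing Instance totally_filter.

HB.instance Definition _ (R : realType) := isPointed.Build R[i] 0.

Section complex_measurable.
Variable R : realType.

Definition complex_pair (z : R[i]) : measurableTypeR R * measurableTypeR R :=
  (complex.Re z, complex.Im z).

(* The Borel sigma-algebra of C, through the identification of C with R^2. *)
Definition complex_measurable : set (set R[i]) :=
  preimage_set_system setT complex_pair measurable.

Let complex_sigma_algebra : sigma_algebra setT complex_measurable.
Proof. exact/sigma_algebra_preimage/sigma_algebra_measurable. Qed.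

Let cm0 : complex_measurable set0.
Proof. by case: complex_sigma_algebra. Qed.

Let cmC A : complex_measurable A -> complex_measurable (~` A).
Proof. by case: complex_sigma_algebra => _ + _ => /[apply]; rewrite setTD. Qed.

Let cmU (F : (set R[i])^nat) : (forall i, complex_measurable (F i)) ->
  complex_measurable (\bigcup_i F i).
Proof. by case: complex_sigma_algebra => _ _; apply. Qed.

HB.instance Definition _ := isMeasurable.Build default_measure_display
  R[i] cm0 cmC cmU.

End complex_measurable.

Section lebesgue_tuple.
Variable R : realType.

Definition tuple_cons n (z : measurableTypeR R * n.-tuple (measurableTypeR R)) :
  n.+1.-tuple (measurableTypeR R) := [tuple of z.1 :: z.2].

Fixpoint lebesgue_tuple (n : nat) :
    set (n.-tuple (measurableTypeR R)) -> \bar R :=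
  match n with
  | 0 => \d_([tuple])
  | n'.+1 =>
    pushforward (lebesgue_measure \x @lebesgue_tuple n')%E (@tuple_cons n')
  end.

Lemma measurable_tuple_cons (n : nat) : measurable_fun setT (@tuple_cons n).
Proof. by apply: measurable_cons; [exact: measurable_fst|exact: measurable_snd]. Qed.

Section step.
Variables (n : nat)
  (m : {sigma_finite_measure set (n.-tuple (measurableTypeR R)) -> \bar R}).

Let step := pushforward (lebesgue_measure \x m)%E (@tuple_cons n).

Let mf := @measurable_tuple_cons n.

Let step0 : step set0 = 0%E. Proof. exact: measure0. Qed.

Let step_ge0 A : (0 <= step A)%E. Proof. exact: measure_ge0. Qed.

Let step_sigma_additive : semi_sigma_additive step.
Proof. exact: (@measure_semi_sigma_additive _ _ _ (pushforward _ _)). Qed.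

HB.instance Definition _ := isMeasure.Build _ _ _ step
  step0 step_ge0 step_sigma_additive.

Let step_sigma_finite : sigma_finite setT step.
Proof.
have /sigma_finiteP[F [FT ndF Foo]] :=
  sigma_finiteT (@lebesgue_measure R : {sigma_finite_measure set _ -> \bar R}).
have /sigma_finiteP[G [GT ndG Goo]] := sigma_finiteT m.
pose u (t : n.+1.-tuple (measurableTypeR R)) := (thead t, [tuple of behead t]).
have uK t : tuple_cons (u t) = t.
  by rewrite /tuple_cons /u [RHS]tuple_eta; apply/val_inj.
have consK z : u (tuple_cons z) = z.
  by case: z => a b; rewrite /u theadE; congr (_, _); apply/val_inj.
have mu_ : measurable_fun setT u.
  apply: measurable_fun_pair; first exact: measurable_tnth.
  exact: measurable_behead.
exists (fun k => u @^-1` (F k `*` G k)).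
  rewrite -preimage_bigcup -(preimage_setT u); congr (_ @^-1` _).
  apply/seteqP; split => // -[x y] _.
  have [k _ Fkx] : (\bigcup_k F k) x by rewrite -FT.
  have [l _ Gly] : (\bigcup_k G k) y by rewrite -GT.
  exists (maxn k l) => //; split => /=.
  - by move: x Fkx; exact/subsetPset/ndF/leq_maxl.
  - by move: y Gly; exact/subsetPset/ndG/leq_maxr.
move=> k; have [mF Fk] := Foo k; have [mG Gk] := Goo k; split.
  by rewrite -[X in measurable X]setTI; apply: mu_ => //; exact: measurableX.
rewrite /step /pushforward.
suff -> : @tuple_cons n @^-1` (u @^-1` (F k `*` G k)) = F k `*` G k.
  by rewrite product_measure1E// lte_mul_pinfty// ge0_fin_numE.
by apply/seteqP; split => z; rewrite /preimage /mkset consK.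
Qed.

HB.instance Definition _ := Measure_isSigmaFinite.Build _ _ _ step
  step_sigma_finite.

Definition lebesgue_step :
  {sigma_finite_measure set (n.+1.-tuple (measurableTypeR R)) -> \bar R} := step.

End step.

Lemma lebesgue_tuple_measure (n : nat) :
  exists m : {sigma_finite_measure set (n.-tuple (measurableTypeR R)) -> \bar R},
    @lebesgue_tuple n = m.
Proof.
elim: n => [|n [m mE]]; first by exists \d_([tuple]).
by exists (lebesgue_step m); rewrite /= mE.
Qed.

Let lebesgue_tuple_sig (n : nat) := cid (lebesgue_tuple_measure n).

Section instances.
Variable n : nat.

Let m := projT1 (lebesgue_tuple_sig n).
Let mE : @lebesgue_tuple n = m := projT2 (lebesgue_tuple_sig n).

Let l0 : @lebesgue_tuple n set0 = 0%E.
Proof. by rewrite mE measure0. Qed.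

Let l_ge0 A : (0 <= @lebesgue_tuple n A)%E.
Proof. by rewrite mE measure_ge0. Qed.

Let l_sigma_additive : semi_sigma_additive (@lebesgue_tuple n).
Proof. by rewrite mE; exact: measure_semi_sigma_additive. Qed.

HB.instance Definition _ := isMeasure.Build _ _ _ (@lebesgue_tuple n)
  l0 l_ge0 l_sigma_additive.

Let l_sigma_finite : sigma_finite setT (@lebesgue_tuple n).
Proof. by rewrite mE; exact: sigma_finiteT. Qed.

HB.instance Definition _ := Measure_isSigmaFinite.Build _ _ _ (@lebesgue_tuple n)
  l_sigma_finite.

End instances.

End lebesgue_tuple.
Arguments lebesgue_tuple {R} n.

Section torus.
Variables (R : realType) (d : nat).
Local Notation Rd := (d.-tuple (measurableTypeR R)).

Definition torus_equiv (x y : Rd) : bool :=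
  `[< exists k : 'rV[int]_d,
        forall i, tnth y i = tnth x i + 2 * pi * (k ord0 i)%:~R >].

Let torus_equiv_refl : reflexive torus_equiv.
Proof. by move=> x; apply/asboolP; exists 0 => i; rewrite mxE mulr0 addr0. Qed.

Let torus_equiv_sym : symmetric torus_equiv.
Proof.
suff h x y : torus_equiv x y -> torus_equiv y x by move=> x y; apply/idP/idP; exact: h.
move=> /asboolP[k xy]; apply/asboolP; exists (- k) => i.
by rewrite xy mxE rmorphN mulrN addrK.
Qed.

Let torus_equiv_trans : transitive torus_equiv.
Proof.
move=> y x z /asboolP[k xy] /asboolP[l yz]; apply/asboolP; exists (k + l) => i.
by rewrite yz xy -addrA -mulrDr -rmorphD mxE.
Qed.

Canonical torus_equiv_rel := EquivRel torus_equiv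
  torus_equiv_refl torus_equiv_sym torus_equiv_trans.

Definition torus : Type := {eq_quot torus_equiv}.
HB.instance Definition _ := Choice.on torus.
HB.instance Definition _ := EqQuotient.on torus.
HB.instance Definition _ := isPointed.Build torus (\pi [tuple 0 | _ < d]).

(* A set is measurable in the torus iff its 2 pi-periodic lift to R^d is. *)
Definition torus_measurable : set (set torus) :=
  image_set_system setT (\pi_torus : Rd -> torus) measurable.

Let torus_measurableE A :
  torus_measurable A = measurable ((\pi_torus : Rd -> torus) @^-1` A).
Proof. by rewrite /torus_measurable /image_set_system/= setTI. Qed.

Let tm0 : torus_measurable set0.
Proof. by rewrite torus_measurableE preimage_set0. Qed.

Let tmC A : torus_measurable A -> torus_measurable (~` A).
Proof. by rewrite !torus_measurableE preimage_setC; exact: measurableC. Qed.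

Let tmU (F : (set torus)^nat) : (forall i, torus_measurable (F i)) ->
  torus_measurable (\bigcup_i F i).
Proof.
move=> mF; rewrite torus_measurableE preimage_bigcup.
by apply: bigcupT_measurable => i; rewrite -torus_measurableE.
Qed.

HB.instance Definition _ := isMeasurable.Build default_measure_display
  torus tm0 tmC tmU.

Definition fundamental_cell : set Rd :=
  [set x | forall i, 0 <= tnth x i < 2 * pi].

Lemma measurable_fundamental_cell : measurable fundamental_cell.
Proof.
rewrite (_ : fundamental_cell =
    \bigcap_(i in [set: 'I_d]) ((tnth (T:=R))^~ i @^-1` `[0, 2 * pi[)).
  apply: fin_bigcap_measurable; first exact: finite_finset.
  move=> i _; rewrite -[X in measurable X]setTI.
  by apply: (@measurable_tnth _ (measurableTypeR R) d i) => //; exact: measurable_itv.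
apply/seteqP; split => x /= h; first by move=> i _ /=; rewrite in_itv/= h.
by move=> i; have := h i I; rewrite /= in_itv.
Qed.

Lemma measurable_torus_lift d' (T' : measurableType d') (f : torus -> T') :
  measurable_fun setT (f \o (\pi_torus : Rd -> torus)) -> measurable_fun setT f.
Proof.
move=> mf _ A mA; rewrite setTI.
change (torus_measurable (f @^-1` A)).
by rewrite torus_measurableE -[X in measurable X]setTI; exact: mf.
Qed.

Lemma measurable_torus_pi : measurable_fun setT (\pi_torus : Rd -> torus).
Proof. by move=> _ A; rewrite setTI => mA; rewrite -torus_measurableE. Qed.

(* The measure dx on the torus, of total mass (2 pi)^d: Lebesgue measure on the
   cell [0, 2 pi)^d, transported to the quotient. *)
Definition torus_measure : set torus -> \bar R :=
  pushforward (mrestr (lebesgue_tuple d) measurable_fundamental_cell)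
    (\pi_torus : Rd -> torus).

Let mf := measurable_torus_pi.

Let t0 : torus_measure set0 = 0%E. Proof. exact: measure0. Qed.

Let t_ge0 A : (0 <= torus_measure A)%E. Proof. exact: measure_ge0. Qed.

Let t_sigma_additive : semi_sigma_additive torus_measure.
Proof. exact: (@measure_semi_sigma_additive _ _ _ (pushforward _ _)). Qed.

HB.instance Definition _ := isMeasure.Build _ _ _ torus_measure
  t0 t_ge0 t_sigma_additive.

End torus.

Arguments torus_measure {R d}.

Section torus_mass.
Variable R : realType.

Lemma lebesgue_tuple_fundamental_cell (d : nat) :
  lebesgue_tuple d (@fundamental_cell R d) = ((2 * pi) ^+ d)%:E.
Proof.
elim: d => [|d ih].
  rewrite /= diracE (_ : _ \in _) ?expr0//.
  by rewrite inE => -[].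
rewrite /= /pushforward.
rewrite (_ : _ @^-1` _ = `[0, 2 * pi[%classic `*` @fundamental_cell R d); last first.
  apply/seteqP; split => -[a t] /=.
    move=> h; split; first by have := h ord0; rewrite in_itv.
    by move=> i; have := h (lift ord0 i); rewrite tnthS.
  by move=> [a0 h] i; case: (unliftP ord0 i) => [j ->|->];
    [rewrite tnthS; exact: h|rewrite in_itv/= in a0].
have mI : measurable (`[0, 2 * pi[%classic : set (measurableTypeR R)).
  exact: measurable_itv.
have mC := @measurable_fundamental_cell R d.
rewrite [LHS](product_measure1E _ _ mI mC).
have muI : lebesgue_measure (`[0, 2 * pi[%classic : set (measurableTypeR R)) =
    (2 * pi)%:E.
  rewrite lebesgue_measure_itv/= lte_fin mulr_gt0 ?pi_gt0//.
  by rewrite oppr0 adde0.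
by rewrite exprS EFinM -ih -muI.
Qed.

Lemma torus_measure_setT (d : nat) :
  torus_measure [set: torus R d] = ((2 * pi) ^+ d)%:E.
Proof.
rewrite /torus_measure /pushforward preimage_setT /mrestr setTI.
exact: lebesgue_tuple_fundamental_cell.
Qed.

End torus_mass.

Section complex_measurable_theory.
Context d (T : measurableType d) (R : realType).
Implicit Types f g : T -> R[i].

Lemma measurable_fun_complexP f : measurable_fun setT f <->
  measurable_fun setT (fun x => complex.Re (f x) : measurableTypeR R) /\
  measurable_fun setT (fun x => complex.Im (f x) : measurableTypeR R).
Proof.
split=> [mf|[mr mi]].
  have mp : measurable_fun setT (@complex_pair R \o f).
    move=> _ A mA; rewrite setTI comp_preimage.
    rewrite -[X in measurable X]setTI; apply: mf => //.
    by exists A => //; rewrite setTI.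
  by split; [exact: (measurableT_comp measurable_fst mp)
            |exact: (measurableT_comp measurable_snd mp)].
move=> _ A [B mB <-]; rewrite !setTI -comp_preimage.
rewrite -[X in measurable X]setTI.
exact: (measurable_fun_pair mr mi).
Qed.

Lemma measurable_normc f : measurable_fun setT f ->
  measurable_fun setT (fun x => Normc.normc (f x)).
Proof.
move=> /measurable_fun_complexP[mr mi].
rewrite (_ : (fun x => _) = @Num.sqrt R \o
  (fun x => complex.Re (f x) ^+ 2 + complex.Im (f x) ^+ 2)); last first.
  by apply/funext => x /=; case: (f x).
apply: measurableT_comp.
  apply: continuous_measurable_fun.
  exact: sqrt_continuous.
by apply: measurable_funD; exact: measurable_funX.
Qed.

Lemma measurable_complexZ (a : R[i]) f : measurable_fun setT f ->
  measurable_fun setT (fun x => a * f x).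
Proof.
move=> /measurable_fun_complexP[mr mi]; apply/measurable_fun_complexP.
case: a => ar ai; split.
  rewrite (_ : (fun x => _) = fun x =>
    ar * complex.Re (f x) - ai * complex.Im (f x)); last first.
    by apply/funext => x; case: (f x).
  by apply: measurable_funB; apply: measurable_funM => //; exact: measurable_cst.
rewrite (_ : (fun x => _) = fun x =>
  ar * complex.Im (f x) + ai * complex.Re (f x)); last first.
  by apply/funext => x; case: (f x).
by apply: measurable_funD; apply: measurable_funM => //; exact: measurable_cst.
Qed.

Lemma measurable_complexD f g : measurable_fun setT f -> measurable_fun setT g ->
  measurable_fun setT (fun x => f x + g x).
Proof.
move=> /measurable_fun_complexP[fr fi] /measurable_fun_complexP[gr gi].
apply/measurable_fun_complexP; split.
  rewrite (_ : (fun x => _) = fun x => complex.Re (f x) + complex.Re (g x)).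
    exact: measurable_funD.
  by apply/funext => x; case: (f x); case: (g x).
rewrite (_ : (fun x => _) = fun x => complex.Im (f x) + complex.Im (g x)).
  exact: measurable_funD.
by apply/funext => x; case: (f x); case: (g x).
Qed.

Lemma measurable_complexB f g : measurable_fun setT f -> measurable_fun setT g ->
  measurable_fun setT (fun x => f x - g x).
Proof.
move=> mf /(measurable_complexZ (-1)) mg.
rewrite (_ : (fun x => _) = fun x => f x + -1 * g x).
  exact: measurable_complexD.
by apply/funext => x; rewrite mulN1r.
Qed.

Lemma measurable_complex_sum (I : Type) (s : seq I) (F : I -> T -> R[i]) :
  (forall i, measurable_fun setT (F i)) ->
  measurable_fun setT (fun x => \sum_(i <- s) F i x).
Proof.
move=> mF; elim: s => [|i s ih].
  by under eq_fun do rewrite big_nil; exact: measurable_cst.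
under eq_fun do rewrite big_cons.
exact: measurable_complexD.
Qed.

End complex_measurable_theory.

Section L2.
Context d (T : measurableType d) (R : realType).
Variable mu : {measure set T -> \bar R}.

Definition L2norm (f : T -> R[i]) : \bar R :=
  Lnorm mu 2%:E (fun x => (Normc.normc (f x))%:E).

Definition square_integrable : {pred T -> R[i]} :=
  [pred f | `[< measurable_fun setT f /\ (L2norm f < +oo)%E >]].

Lemma L2norm_le_Lnorm (f : T -> R[i]) (h : T -> R) :
  measurable_fun setT f -> measurable_fun setT h ->
  (forall x, Normc.normc (f x) <= h x) ->
  (L2norm f <= Lnorm mu 2%:E (EFin \o h))%E.
Proof.
move=> mf mh fh; rewrite /L2norm unlock.
apply: gt0_ler_poweR; rewrite ?invr_ge0 ?ler0n// ?in_itv/= ?leey ?andbT.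
- by apply: integral_ge0 => x _; rewrite lee_fin powR_ge0.
- by apply: integral_ge0 => x _; rewrite lee_fin powR_ge0.
apply: ge0_le_integral => //=.
- apply/measurable_EFinP; apply: (measurableT_comp (measurable_powR _)).
  by apply: measurableT_comp => //; exact: measurable_normc.
- apply/measurable_EFinP; apply: (measurableT_comp (measurable_powR _)).
  exact: measurableT_comp.
- move=> x _; rewrite lee_fin ge0_ler_powR ?nnegrE//.
  have n0 : 0 <= Normc.normc (f x) by case: (f x) => a b; exact: sqrtr_ge0.
  by rewrite !ger0_norm// (le_trans n0).
Qed.

Lemma L2norm_lty (f : T -> R[i]) (h : T -> R) :
  measurable_fun setT f -> h \in @Lfun _ T R mu 2%:E ->
  (forall x, Normc.normc (f x) <= h x) -> (L2norm f < +oo)%E.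
Proof.
move=> mf /andP[/[!inE] mh]; rewrite /finite_norm => hoo fh.
exact: le_lt_trans (L2norm_le_Lnorm mf mh fh) hoo.
Qed.

Lemma L2norm_triangle (f g h : T -> R[i]) :
  measurable_fun setT f -> measurable_fun setT g -> measurable_fun setT h ->
  (forall x, Normc.normc (h x) <= Normc.normc (f x) + Normc.normc (g x)) ->
  (L2norm h <= L2norm f + L2norm g)%E.
Proof.
move=> /measurable_normc mf /measurable_normc mg mh hfg.
have mfg : measurable_fun setT (fun x => Normc.normc (f x) + Normc.normc (g x)).
  exact: measurable_funD.
apply: (le_trans (L2norm_le_Lnorm mh mfg hfg)).
by apply: (eminkowski mu mf mg); rewrite lee_fin ler1n.
Qed.

Lemma L2norm_eq0 (f : T -> R[i]) : measurable_fun setT f -> L2norm f = 0%E ->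
  {ae mu, forall x, f x = 0}.
Proof.
move=> /measurable_normc mf.
have /Lnorm_eq0_eq0 : measurable_fun setT (fun x => (Normc.normc (f x))%:E).
  exact/measurable_EFinP.
move=> /[apply] h; apply: filterS (h _) => [x /(_ I)[]/=|//].
by move=> /Normc.eq0_normc.
Qed.

Lemma square_integrable_normc (f : T -> R[i]) : f \in square_integrable ->
  (fun x => Normc.normc (f x)) \in @Lfun _ T R mu 2%:E.
Proof.
rewrite inE => -[mf foo]; apply/andP; split; rewrite inE//=.
exact: measurable_normc.
Qed.

Let two_ge1 : (1 <= 2%:E :> \bar R)%E. Proof. by rewrite lee_fin ler1n. Qed.

Lemma square_integrable_submod_closed : submod_closed square_integrable.
Proof.
split=> [|a f g fL gL].
  rewrite inE; split; first exact: measurable_cst.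
  rewrite /L2norm (_ : (fun x => _) = cst 0%E) ?Lnorm0 ?ltry//.
  by apply/funext => x; congr EFin; exact: Normc.normc0.
have mafg : measurable_fun setT (a *: f + g).
  have := gL; rewrite inE => -[mg _].
  have := fL; rewrite inE => -[/(measurable_complexZ a) mf _].
  exact: (measurable_complexD mf mg).
rewrite inE; split => //.
apply: (@L2norm_lty _ (Normc.normc a *: (fun x => Normc.normc (f x)) +
    (fun x => Normc.normc (g x)))) => //.
  have [_ h] := Lfun_submod_closed mu two_ge1.
  by apply: h; exact: square_integrable_normc.
by move=> x; rewrite !fctE (le_trans (le_normcD _ _))// Normc.normcM.
Qed.

HB.instance Definition _ := GRing.isSubmodClosed.Build R[i] (T -> R[i])
  square_integrable square_integrable_submod_closed.

Record L2fun := MkL2fun {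
  L2fun_val :> T -> R[i] ;
  L2funP : L2fun_val \in square_integrable }.

HB.instance Definition _ := [isSub for L2fun_val].
HB.instance Definition _ := [Choice of L2fun by <:].
HB.instance Definition _ := [SubChoice_isSubLmodule of L2fun by <:].

Definition ae_null : {pred L2fun} :=
  [pred f : L2fun | `[< {ae mu, forall x, f x = 0} >]].

Lemma ae_null_zmod_closed : zmod_closed ae_null.
Proof.
split=> [|f g]; rewrite !inE.
  exact: aeW.
move=> f0 g0.
by apply: filterS2 f0 g0 => x fx gx; rewrite -[LHS]/(f x - g x) fx gx subrr.
Qed.

HB.instance Definition _ := GRing.isZmodClosed.Build L2fun ae_null
  ae_null_zmod_closed.

Definition L2 : Type := Quotient.quot ae_null.

HB.instance Definition _ := GRing.Zmodule.on L2.
HB.instance Definition _ := EqQuotient.on L2.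

Definition L2_class (f : L2fun) : L2 := \pi_L2 f.

(* An element of L^2 is evaluated through a chosen representative of its class,
   so pointwise statements about it are only meaningful almost everywhere. *)
Definition L2_repr (f : L2) : T -> R[i] := repr f.
Coercion L2_repr : L2 >-> Funclass.

Lemma L2_classP (f g : L2fun) :
  L2_class f = L2_class g <-> {ae mu, forall x, f x = g x}.
Proof.
have -> : (L2_class f = L2_class g) <-> (f - g \in ae_null).
  rewrite Quotient.idealrBE; split=> [/eqP//|/eqP//].
rewrite inE; split; apply: filterS => x.
  by rewrite -[LHS]/(f x - g x) => /eqP; rewrite subr_eq0 => /eqP.
by move=> fg; rewrite -[LHS]/(f x - g x) fg subrr.
Qed.

Lemma L2_class_ae (f : L2fun) : {ae mu, forall x, L2_class f x = f x}.
Proof. by apply/L2_classP; rewrite /L2_class reprK. Qed.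

Lemma L2_eqP (f g : L2) : f = g <-> {ae mu, forall x, f x = g x}.
Proof. by rewrite -L2_classP /L2_class !reprK. Qed.

Lemma L2_square_integrable (f : L2) : (f : T -> R[i]) \in square_integrable.
Proof. exact: L2funP. Qed.

Definition L2_scale (a : R[i]) (f : L2) : L2 := L2_class (a *: repr f).

Lemma L2_class_scale (a : R[i]) (f : L2fun) :
  L2_scale a (L2_class f) = L2_class (a *: f).
Proof.
apply/L2_classP; apply: filterS (L2_class_ae f) => x fx.
by rewrite -[LHS]/(a * L2_class f x) fx.
Qed.

Let L2_classK (f : L2) : L2_class (repr f) = f.
Proof. exact: reprK. Qed.

Let L2_classD (f g : L2fun) : L2_class (f + g) = L2_class f + L2_class g.
Proof. by rewrite /L2_class !piE. Qed.

Let L2_scalerA (a b : R[i]) (f : L2) :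
  L2_scale a (L2_scale b f) = L2_scale (a * b) f.
Proof. by rewrite -[f]L2_classK !L2_class_scale scalerA. Qed.

Let L2_scale1r : left_id 1 L2_scale.
Proof. by move=> f; rewrite -[f]L2_classK L2_class_scale scale1r. Qed.

Let L2_scalerDr : right_distributive L2_scale +%R.
Proof.
move=> a f g; rewrite -[f]L2_classK -[g]L2_classK -L2_classD !L2_class_scale.
by rewrite scalerDr L2_classD.
Qed.

Let L2_scalerDl (f : L2) : {morph L2_scale^~ f : a b / a + b}.
Proof.
by move=> a b /=; rewrite -[f]L2_classK !L2_class_scale scalerDl L2_classD.
Qed.

HB.instance Definition _ := GRing.Zmodule_isLmodule.Build R[i] L2
  L2_scalerA L2_scale1r L2_scalerDr L2_scalerDl.

Lemma L2_addE (f g : L2) : {ae mu, forall x, (f + g : L2) x = f x + g x}.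
Proof.
have := L2_class_ae (repr f + repr g).
by rewrite L2_classD !L2_classK.
Qed.

Lemma L2_scaleE (a : R[i]) (f : L2) : {ae mu, forall x, (a *: f : L2) x = a * f x}.
Proof. exact: (L2_class_ae (a *: repr f)). Qed.

End L2.

Definition Cintegral d (T : measurableType d) (R : realType)
    (mu : {measure set T -> \bar R}) (f : T -> R[i]) : R[i] :=
  (\int[mu]_x complex.Re (f x)) +i* (\int[mu]_x complex.Im (f x)).

Section fourier.
Variables (R : realType) (d : nat).
Local Notation Rd := (d.-tuple (measurableTypeR R)).
Local Notation Zd := 'rV[int]_d.
Local Notation Td := (torus R d).
Local Notation L2T := (L2 (@torus_measure R d)).

Definition cis (t : R) : R[i] := cos t +i* sin t.

Definition dot (k : Zd) (x : Rd) : R := \sum_(i < d) (k ord0 i)%:~R * tnth x i.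

(* e^{i k.x} at a point of the torus, computed on an arbitrary lift to R^d; see
   [expi_pi] for the independence from the lift. *)
Definition expi (k : Zd) (x : Td) : R[i] := cis (dot k (repr x)).

Lemma cis_period (t : R) (n : int) : cis (t + 2 * pi * n%:~R) = cis t.
Proof.
have h (m : nat) u : cis (u + (pi *+ 2) *+ m) = cis u.
  by rewrite /cis (periodicn (@cosD2pi R)) (periodicn (@sinD2pi R)).
have -> : 2 * pi * n%:~R = (pi *+ 2) *~ n :> R by rewrite -[RHS]mulrzr mulr_natl.
case: n => m; first exact: h.
by rewrite NegzE mulrNz -[in RHS](subrK ((pi *+ 2) *+ m.+1) t) h.
Qed.

Lemma expi_pi (k : Zd) (x : Rd) : expi k (\pi_(torus R d) x) = cis (dot k x).
Proof.
have /eqmodP/asboolP[l xl] : x = repr (\pi_(torus R d) x) %[mod torus R d].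
  by rewrite reprK.
rewrite /expi; set y := repr _ in xl *.
have -> : dot k y = dot k x + 2 * pi * (\sum_i k ord0 i * l ord0 i)%:~R.
  rewrite /dot rmorph_sum/= mulr_sumr -big_split/=; apply: eq_bigr => i _.
  by rewrite xl mulrDr rmorphM/= mulrCA.
exact: cis_period.
Qed.

Definition fourier_coef (g : Td -> R[i]) (k : Zd) : R[i] :=
  (((2 * pi) ^+ d)^-1)%:C *
  Cintegral torus_measure (fun x => g x * expi (- k) x).

(* [is_inverse_fourier c g] : F^{-1}(c) = g, i.e. the finite partial sums of
   sum_k c_k e^{i k.x} converge to g in L^2, as a net over the finite subsets
   of Z^d; such a g is unique ([is_inverse_fourier_unique]). *)
Definition is_inverse_fourier (c : Zd -> R[i]) (g : L2T) : Prop :=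
  (fun K : {fset Zd} =>
     L2norm torus_measure (fun x => \sum_(k <- K) c k * expi k x - g x))
    @ totally --> 0%E.

Lemma measurable_expi (k : Zd) : measurable_fun setT (expi k).
Proof.
apply: measurable_torus_lift.
rewrite (_ : _ \o _ = fun x => cis (dot k x)); last first.
  by apply/funext => x; exact: expi_pi.
have md : measurable_fun setT (dot k : Rd -> R).
  apply: measurable_sum => i; apply: measurable_funM => //.
  exact: (@measurable_tnth _ (measurableTypeR R)).
apply/measurable_fun_complexP; split => /=.
- by apply: measurableT_comp md; apply: continuous_measurable_fun; exact: continuous_cos.
- by apply: measurableT_comp md; apply: continuous_measurable_fun; exact: continuous_sin.
Qed.

Lemma is_inverse_fourier_unique (c : Zd -> R[i]) (g h : L2T) :
  is_inverse_fourier c g -> is_inverse_fourier c h -> g = h.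
Proof.
have mL (f : L2T) : measurable_fun setT f.
  by have := L2_square_integrable f; rewrite inE => -[].
have mB (u v : Td -> R[i]) : measurable_fun setT u -> measurable_fun setT v ->
    measurable_fun setT (fun x => u x - v x).
  exact: measurable_complexB.
have mS K : measurable_fun setT (fun x => \sum_(k <- enum_fset K) c k * expi k x).
  apply: measurable_complex_sum => k; apply: measurable_complexZ.
  exact: measurable_expi.
move=> cg ch; apply/L2_eqP.
suff /(L2norm_eq0 (mB _ _ (mL g) (mL h))) :
    L2norm torus_measure (fun x => g x - h x) = 0%E.
  by apply: filterS => x /eqP; rewrite subr_eq0 => /eqP.
apply/eqP; rewrite eq_le Lnorm_ge0 andbT.
have zD : (0 +? (0 : \bar R))%E by [].
have := cvgeD zD cg ch; rewrite adde0 => c0.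
apply: (cvge_ge _ (c0 _)); apply: nearW => K.
apply: L2norm_triangle; [exact: mB|exact: mB|exact: mB|].
move=> x; rewrite (_ : g x - h x = - (\sum_(k <- K) c k * expi k x - g x) +
  (\sum_(k <- K) c k * expi k x - h x)).
  by rewrite (le_trans (le_normcD _ _))// normcN.
by rewrite opprB addrA subrK.
Qed.

End fourier.

Section ABLE.
Variables (R : realType) (d M : nat).
Local Notation Zd := 'rV[int]_d.
Local Notation Td := (torus R d).
Local Notation L2T := (L2 (@torus_measure R d)).
Variables (p : Td -> R[i] -> 'I_M -> R) (r : Zd -> 'I_M -> R[i]).

Definition sqrt_weight (f : L2T) (m : 'I_M) (x : Td) : R[i] :=
  (Num.sqrt (p x (f x) m))%:C.

(* [is_ABLE G] : G is the operator
     f |-> sum_m sqrt(p(., f(.), m)) F^{-1}[r(., m) F(sqrt(p(., f(.), m)) f)],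
   with [g m] the m-th inverse transform. All the conditions are insensitive to
   the representatives of f and [g m], and G is unique ([is_ABLE_unique]). *)
Definition is_ABLE (G : L2T -> L2T) : Prop :=
  forall f : L2T, exists g : 'I_M -> L2T,
    (forall m, is_inverse_fourier
       (fun k => r k m * fourier_coef (fun x => sqrt_weight f m x * f x) k)
       (g m)) /\
    {ae torus_measure, forall x, G f x = \sum_(m < M) sqrt_weight f m x * g m x}.

Lemma is_ABLE_unique (G H : L2T -> L2T) : is_ABLE G -> is_ABLE H -> G = H.
Proof.
move=> hG hH; apply/funext => f; apply/L2_eqP.
have [g [fg Gg]] := hG f; have [h [fh Hh]] := hH f.
have gh : g = h by apply/funext => m; exact: is_inverse_fourier_unique (fg m) (fh m).
by apply: filterS2 Gg Hh => x -> ->; rewrite gh.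
Qed.

End ABLE.

(* Main.v *)
(* Take M = 2, let p(x, v, .) put all its mass on the first index when Re v = 1
   and on the second one otherwise, and let the multiplier keep only the zero
   frequency of the first branch. The operator is then
   f |-> 1_{Re f = 1} * mean(1_{Re f = 1} f), which maps the constant 1 to 1 but
   the constant 2 to 0. Since the multiplier has finite support, every inverse
   Fourier transform involved is a constant function. *)
Require Import Defs.
From HB Require Import structures.
From mathcomp Require Import all_boot all_order all_algebra finmap.
From mathcomp Require Import ring_quotient complex.
From mathcomp Require Import all_classical all_reals all_analysis.
From mathcomp Require Import measurable_realfun.
Import Order.TTheory GRing.Theory Num.Theory.
Import numFieldNormedType.Exports.

Local Open Scope classical_set_scope.
Local Open Scope ring_scope.
Local Open Scope complex_scope.

(** * Measurability and integration of complex-valued functions *)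

Lemma measurable_complexM d (T : measurableType d) (R : realType)
    (f g : T -> R[i]) :
  measurable_fun setT f -> measurable_fun setT g ->
  measurable_fun setT (fun x => f x * g x).
Proof.
move=> /measurable_fun_complexP[fr fi] /measurable_fun_complexP[gr gi].
apply/measurable_fun_complexP; split.
  rewrite (_ : (fun x => _) = fun x => complex.Re (f x) * complex.Re (g x) -
      complex.Im (f x) * complex.Im (g x)).
    by apply: measurable_funB; exact: measurable_funM.
  by apply/funext => x; case: (f x); case: (g x).
rewrite (_ : (fun x => _) = fun x => complex.Re (f x) * complex.Im (g x) +
    complex.Im (f x) * complex.Re (g x)).
  by apply: measurable_funD; exact: measurable_funM.
by apply/funext => x; case: (f x); case: (g x).
Qed.

Section L2_finite_measure.
Context d (T : measurableType d) (R : realType).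
Variable mu : {measure set T -> \bar R}.

(** The integrand of the squared norm vanishes almost everywhere; this is the converse of
    [L2norm_eq0]. *)
Lemma L2norm_ae0 (f : T -> R[i]) : measurable_fun setT f ->
  {ae mu, forall x, f x = 0} -> L2norm mu f = 0%E.
Proof.
move=> mf f0; rewrite /L2norm unlock (ae_eq_integral (cst 0%E))//.
- by rewrite integral0 poweR0r// invr_neq0// pnatr_eq0.
- apply/measurable_EFinP; apply: (measurableT_comp (measurable_powR _)).
  by apply: measurableT_comp => //; exact: measurable_normc.
- apply: filterS f0 => x fx _.
  by rewrite /= fx Normc.normc0 normr0 powR0// pnatr_eq0.
Qed.

(** Under a finite measure the constant [B] is itself in L^2, and it dominates [f]. *)
Lemma L2norm_bounded_lty (f : T -> R[i]) (B : R) : (mu setT < +oo)%E ->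
  measurable_fun setT f -> (forall x, Normc.normc (f x) <= B) ->
  (L2norm mu f < +oo)%E.
Proof.
move=> muoo mf fB.
apply: (@L2norm_lty _ _ _ _ _ (cst B)) => //.
apply/andP; split; rewrite inE//=.
rewrite /finite_norm unlock poweR_lty//.
rewrite (integral_cst mu measurableT (`|B| `^ 2)%R%:E).
by rewrite lte_mul_pinfty// lee_fin powR_ge0.
Qed.

Lemma Cintegral_ae_cst (f : T -> R[i]) (c : R[i]) : measurable_fun setT f ->
  {ae mu, forall x, f x = c} -> Cintegral mu f = (fine (mu setT))%:C * c.
Proof.
move=> /measurable_fun_complexP[mr mi] fc.
(* Real and imaginary parts are treated separately. When the total mass is infinite both sides are
   0, since [fine] sends infinite values to 0. *)
have int_cst (u : T -> R) a : measurable_fun setT u ->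
    {ae mu, forall x, u x = a} -> \int[mu]_x u x = a * fine (mu setT).
  move=> mu_ ua; rewrite -Rintegral_cst//; congr fine.
  apply: ae_eq_integral => //; first exact/measurable_EFinP.
  by apply: filterS ua => x -> _.
rewrite /Cintegral (int_cst _ (complex.Re c))//; last by apply: filterS fc => x ->.
rewrite (int_cst _ (complex.Im c))//; last by apply: filterS fc => x ->.
case: c {fc} => a b; rewrite /= [RHS]/GRing.mul/= !mul0r subr0 addr0.
by rewrite ![fine _ * _]mulrC.
Qed.

End L2_finite_measure.

(** * Constant functions on the torus and their Fourier transforms *)

Section torus_constants.
Variables (R : realType) (d : nat).
Local Notation Td := (torus R d).
Local Notation mu := (@torus_measure R d).
Local Notation L2T := (L2 mu).

Lemma torus_measure_lty : (mu setT < +oo)%E.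
Proof. by rewrite torus_measure_setT ltry. Qed.

Lemma torus_bounded_L2 (f : Td -> R[i]) (B : R) : measurable_fun setT f ->
  (forall x, Normc.normc (f x) <= B) -> f \in square_integrable mu.
Proof.
move=> mf fB; rewrite inE; split => //.
exact: (L2norm_bounded_lty _ _ _ _ _ _ torus_measure_lty mf fB).
Qed.

Lemma cst_square_integrable (c : R[i]) : cst c \in square_integrable mu.
Proof. by apply: (torus_bounded_L2 _ (Normc.normc c)); first exact: measurable_cst. Qed.

(** These classes serve twice: as test inputs for linearity, and as the inverse Fourier transforms
    of the multiplied coefficients. *)
Definition L2_cst (c : R[i]) : L2T := L2_class (MkL2fun (cst_square_integrable c)).

Lemma L2_cstE c : {ae mu, forall x, L2_cst c x = c}.
Proof. exact: (L2_class_ae (MkL2fun (cst_square_integrable c))). Qed.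

Lemma L2_cstD a b : L2_cst a + L2_cst b = L2_cst (a + b).
Proof.
have ab : {ae mu, forall x, L2_cst a x + L2_cst b x = a + b}.
  by apply: filterS2 (L2_cstE a) (L2_cstE b) => x -> ->.
apply/L2_eqP; move: (L2_addE (L2_cst a) (L2_cst b)) ab (L2_cstE (a + b)).
by apply: filterS3 => x -> -> ->.
Qed.

Lemma L2_cst_inj : injective L2_cst.
Proof.
move=> a b ab; apply/eqP/negPn/negP => ab0.
(* Distinct constants that agree almost everywhere would make the whole torus a null set, against
   its mass (2 pi)^d > 0. *)
have : {ae mu, forall x : Td, False}.
  move: (L2_cstE a) (L2_cstE b); apply: filterS2 => x.
  by rewrite ab => -> /eqP; rewrite (negbTE ab0).
case=> A [mA A0 sA].
have : mu setT = 0%E.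
  apply/eqP; rewrite eq_le measure_ge0 andbT -A0 le_measure ?inE// => x _.
  exact: sA.
rewrite torus_measure_setT => -[/eqP]; rewrite expf_eq0 mulf_eq0 pnatr_eq0/=.
by rewrite (negbTE (lt0r_neq0 (pi_gt0 R))) andbF.
Qed.

Lemma measurable_L2 (f : L2T) : measurable_fun setT f.
Proof. by have := L2_square_integrable f; rewrite inE => -[]. Qed.

Lemma expi0 (x : Td) : expi 0 x = 1.
Proof.
rewrite /expi /cis /dot big1 ?cos0 ?sin0// => i _.
by rewrite mxE mul0r.
Qed.

Lemma is_inverse_fourier_cst (c : 'rV[int]_d -> R[i]) :
  (forall k, k != 0 -> c k = 0) -> is_inverse_fourier c (L2_cst (c 0)).
Proof.
move=> c0; apply: cvg_near_cst.
(* The net is stationary from the index {0} on: if [K] contains 0, only the zero frequency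
   contributes, and the error vanishes almost everywhere. *)
exists [fset 0]%fset => // K /=; rewrite fsub1set => K0.
apply: L2norm_ae0.
  apply: measurable_complexB; last exact: measurable_L2.
  apply: measurable_complex_sum => k; apply: measurable_complexZ.
  exact: measurable_expi.
apply: filterS (L2_cstE (c 0)) => x ->.
rewrite (big_fsetD1 0)//= expi0 mulr1 big1_fset ?addr0 ?subrr// => k.
by rewrite in_fsetD1 => /andP[/c0-> _] _; rewrite mul0r.
Qed.

(** At frequency 0 the exponential is 1, and the factor (2 pi)^(-d) cancels the mass of the
    torus. *)
Lemma fourier_coef0_ae_cst (f : Td -> R[i]) (c : R[i]) : measurable_fun setT f ->
  {ae mu, forall x, f x = c} -> fourier_coef f 0 = c.
Proof.
move=> mf fc; rewrite /fourier_coef oppr0.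
under [X in Cintegral _ X]eq_fun do rewrite expi0 mulr1.
rewrite (Cintegral_ae_cst _ _ _ _ _ c)//.
rewrite [X in fine X](torus_measure_setT R d) mulrA -rmorphM/=.
rewrite mulVf ?mul1r// expf_neq0// mulf_neq0 ?pnatr_eq0//.
exact/lt0r_neq0/pi_gt0.
Qed.

End torus_constants.

(** * The gated mean as an ABLE operator, and its values on constants *)

Section gated_mean.
Variables (R : realType) (d : nat).
Local Notation Td := (torus R d).
Local Notation mu := (@torus_measure R d).
Local Notation L2T := (L2 mu).

(** The weights are complementary indicators, so they sum to 1 and each equals its own square
    root. *)
Definition gate (x : Td) (v : R[i]) (m : 'I_2) : R :=
  if m == ord0 then \1_[set 1] (complex.Re v) else \1_(~` [set 1]) (complex.Re v).

Definition mean_multiplier (k : 'rV[int]_d) (m : 'I_2) : R[i] :=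
  if (k == 0) && (m == ord0) then 1 else 0.

(** The maps [h] and [g] are general so as to cover both the joint measurability of [gate], with the
    two projections, and that of its composition with an input [f]. *)
Lemma measurable_gate d' (T : measurableType d') (h : T -> Td) (g : T -> R[i]) m :
  measurable_fun setT g -> measurable_fun setT (fun x => gate (h x) (g x) m).
Proof.
move=> /measurable_fun_complexP[mg _]; rewrite /gate.
have mi (A : set (measurableTypeR R)) : measurable A ->
    measurable_fun setT (fun x => \1_A (complex.Re (g x)) : R).
  by move=> mA; exact: (measurableT_comp (measurable_indic mA) mg).
by case: (m == ord0); apply: mi => //; exact: measurableC.
Qed.

Lemma gate_ge0 x v m : 0 <= gate x v m.
Proof. by rewrite /gate; case: ifP => _; rewrite indicE. Qed.

Lemma gate_sum x v : \sum_(m < 2) gate x v m = 1.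
Proof.
rewrite big_ord_recl big_ord1 /gate /= !indicE in_setC.
by case: (_ \in _) => /=; rewrite ?addr0 ?add0r.
Qed.

Lemma gate_le1 x v m : gate x v m <= 1.
Proof. by rewrite /gate; case: ifP => _; rewrite indicE lern1 leq_b1. Qed.

Lemma measurable_sqrt_gate (f : L2T) m : measurable_fun setT (sqrt_weight gate f m).
Proof.
apply/measurable_fun_complexP; split => /=; last exact: measurable_cst.
apply: measurableT_comp.
  by apply: continuous_measurable_fun; exact: sqrt_continuous.
apply: (measurable_gate _ _ id); exact: measurable_L2.
Qed.

(** The weight has modulus at most 1; this bound puts the output of the operator in L^2. *)
Lemma sqrt_gate0_bounded (f : L2T) (c : R[i]) x :
  Normc.normc (c * sqrt_weight gate f ord0 x) <= Normc.normc c.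
Proof.
rewrite Normc.normcM /sqrt_weight -[leRHS]mulr1 ler_wpM2l//.
  by case: c => a b; exact: sqrtr_ge0.
rewrite /= expr0n addr0 sqrtr_sqr ger0_norm ?sqrtr_ge0//.
by rewrite -sqrtr1 ler_wsqrtr// gate_le1.
Qed.

(** The zeroth Fourier coefficient is the normalised mean, here of the gated input. *)
Definition gated_mean (f : L2T) : R[i] :=
  fourier_coef (fun x => sqrt_weight gate f ord0 x * f x) 0.

Lemma gated_mean_square_integrable (f : L2T) :
  (fun x => gated_mean f * sqrt_weight gate f ord0 x) \in square_integrable mu.
Proof.
apply: torus_bounded_L2; last exact: sqrt_gate0_bounded.
by apply: measurable_complexZ; exact: measurable_sqrt_gate.
Qed.

Definition gated_mean_op (f : L2T) : L2T :=
  L2_class (MkL2fun (gated_mean_square_integrable f)).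

Lemma gated_mean_opE (f : L2T) : {ae mu, forall x,
  gated_mean_op f x = gated_mean f * sqrt_weight gate f ord0 x}.
Proof. exact: (L2_class_ae (MkL2fun (gated_mean_square_integrable f))). Qed.

Lemma gated_mean_op_ABLE : is_ABLE gate mean_multiplier gated_mean_op.
Proof.
move=> f; pose c m k := mean_multiplier k m *
  fourier_coef (fun x => sqrt_weight gate f m x * f x) k.
(* The coefficients [c m] vanish off frequency 0, so each inverse transform is the constant [c m 0];
   for the second branch this constant is 0. *)
exists (fun m => L2_cst R d (c m 0)); split.
  move=> m; apply: (@is_inverse_fourier_cst R d (c m)) => k k0.
  by rewrite /c /mean_multiplier (negbTE k0) mul0r.
move: (gated_mean_opE f) (L2_cstE _ d (c ord0 0)) (L2_cstE _ d (c (lift ord0 ord0) 0)).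
apply: filterS3 => x -> c0 c1.
rewrite big_ord_recl big_ord1 c0 c1 /c /mean_multiplier eqxx/= !mul0r mul1r.
by rewrite mulr0 addr0 mulrC.
Qed.

(** The chosen representative of a constant class equals that constant only off a null set, hence
    the almost everywhere form. *)
Lemma sqrt_gate0_cst (a : R) :
  {ae mu, forall x, sqrt_weight gate (L2_cst R d a%:C) ord0 x = (a == 1)%:R%:C}.
Proof.
apply: filterS (L2_cstE _ d a%:C) => x xE.
rewrite /sqrt_weight xE /gate/= indicE in_set1.
by case: (a == 1); rewrite ?sqrtr1 ?sqrtr0.
Qed.

Lemma gated_mean_op_cst (a : R) :
  gated_mean_op (L2_cst R d a%:C) = L2_cst R d (a == 1)%:R%:C.
Proof.
(* With w the value of the weight, 1 if a = 1 and 0 otherwise, the mean of the gated input is w * a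
   and the outer weight gives another w. The product w * a * w reduces to w in both cases. *)
have -> : gated_mean_op (L2_cst R d a%:C) =
    L2_cst R d (((a == 1)%:R%:C * a%:C) * (a == 1)%:R%:C).
  apply/L2_eqP; move: (gated_mean_opE (L2_cst R d a%:C)) (sqrt_gate0_cst a)
    (L2_cstE _ d (((a == 1)%:R%:C * a%:C) * (a == 1)%:R%:C)).
  apply: filterS3 => x -> -> ->; congr (_ * _).
  apply: fourier_coef0_ae_cst.
    by apply: measurable_complexM; [exact: measurable_sqrt_gate|exact: measurable_L2].
  by move: (sqrt_gate0_cst a) (L2_cstE _ d a%:C); apply: filterS2 => y -> ->.
by case: eqVneq => [->|]; rewrite ?mulr1// mulr0.
Qed.

Lemma gated_mean_op_nonlinear : ~ linear gated_mean_op.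
Proof.
(* Additivity is tested on 1 + 1: the operator sends the sum to 0, whereas the images add up to
   2. *)
move=> /(_ 1 (L2_cst R d 1%:C) (L2_cst R d 1%:C)).
rewrite !scale1r L2_cstD -rmorphD/= !gated_mean_op_cst eqxx L2_cstD.
have /negbTE-> : 1 + 1 != 1 :> R by rewrite -subr_eq0 addrK oner_eq0.
move=> /L2_cst_inj/eqP; rewrite eq_complex/= eq_sym.
by rewrite -[1 + 1](natrD _ 1 1) pnatr_eq0.
Qed.

End gated_mean.

Theorem theorem9 (R : realType) (d : nat) (hd : (1 <= d)%N) :
  exists (M : nat) (p : torus R d -> R[i] -> 'I_M -> R)
         (r : 'rV[int]_d -> 'I_M -> R[i]),
    [/\ (1 <= M)%N,
        (forall m, measurable_fun [set: torus R d * R[i]]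
           (fun xv : torus R d * R[i] => p xv.1 xv.2 m)),
        (forall x v m, 0 <= p x v m) /\
          (forall x v, \sum_(m < M) p x v m = 1),
        (exists B : R, forall k m, `|r k m| <= B%:C) &
        exists G : L2 (@torus_measure R d) -> L2 (@torus_measure R d),
          is_ABLE p r G /\ ~ linear G].
Proof.
exists 2%N, (@gate R d), (@mean_multiplier R d); split => //.
- by move=> m; exact: (measurable_gate _ _ _ _ fst snd m measurable_snd).
- by split; [exact: gate_ge0|exact: gate_sum].
- exists 1 => k m; rewrite /mean_multiplier.
  by case: ifP => _; rewrite ?normr1// normr0 ler01.
- exists (@gated_mean_op R d).
  by split; [exact: gated_mean_op_ABLE|exact: gated_mean_op_nonlinear].
Qed.
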